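(* Let $\rho>0$ be given. (i) If $(x^*,\lambda^* )$ is a KKT pair of problem (P$_\rho$) with $c_i(x^* )=0$ for all $i\in\mathcal E$, then $(x^*,\lambda^*_{\mathcal I},\lambda^*_{\mathcal E}-\rho e)$ is a KKT pair of problem (P). (ii) If $\lambda^*_{\mathcal E}\ge0$ and $(x^*,\lambda^*_{\mathcal I},\lambda^*_{\mathcal E}-\rho e)$ is a KKT pair of problem (P), then $(x^*,\lambda^* )$ is a KKT pair of problem (P$_\rho$).
   Context: $\mathcal{M}$ is a complete Riemannian manifold of dimension $n$; $\mathcal I=\{1,\dots,m\}$, $\mathcal E=\{m+1,\dots,m+\ell\}$, $\mathcal L=\mathcal I\cup\mathcal E$; $f,c_i:\mathcal M\to\mathbb R$ ($i\in\mathcal L$) are twice continuously differentiable; $\mathrm{grad}$ is the Riemannian gradient. Problem (P): minimize $f(x)$ over $x\in\mathcal M$ subject to $c_i(x)\le0$ ($i\in\mathcal I$), $c_i(x)=0$ ($i\in\mathcal E$). For $\rho>0$ let $F_\rho=f-\rho\sum_{i\in\mathcal E}c_i$; problem (P$_\rho$): minimize $F_\rho(x)$ over $x\in\mathcal M$ subject to $c_i(x)\le0$ for all $i\in\mathcal L$. A pair $(x,\lambda)\in\mathcal M\times\mathbb R^{m+\ell}$ is a KKT pair of (P) if $\mathrm{grad}f(x)+\sum_{i\in\mathcal L}\lambda_i\mathrm{grad}\,c_i(x)=0_x$; $\lambda_i\ge0$, $c_i(x)\le0$, $\lambda_ic_i(x)=0$ for $i\in\mathcal I$; and $c_i(x)=0$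 for $i\in\mathcal E$. It is a KKT pair of (P$_\rho$) if $\mathrm{grad}F_\rho(x)+\sum_{i\in\mathcal L}\lambda_i\mathrm{grad}\,c_i(x)=0_x$ and $\lambda_i\ge0$, $c_i(x)\le0$, $\lambda_ic_i(x)=0$ for $i\in\mathcal L$. For $\lambda\in\mathbb R^{m+\ell}$, $\lambda_{\mathcal S}=(\lambda_i)_{i\in\mathcal S}$, so $\lambda=(\lambda_{\mathcal I},\lambda_{\mathcal E})$; $e$ is the all-ones vector; vector inequalities are componentwise. *)

(* Defs.v *)
From HB Require Import structures.
From mathcomp Require Import all_boot all_order all_algebra.
From mathcomp Require Import all_classical all_reals all_analysis.

Set Implicit Arguments.
Unset Strict Implicit.
Unset Printing Implicit Defensive.

Import Order.TTheory GRing.Theory Num.Theory.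
Import numFieldNormedType.Exports.

Local Open Scope classical_set_scope.
Local Open Scope ring_scope.

(* [f] is of class C^k on the open set [U]. *)
Fixpoint Ck (R : realType) (V W : normedModType R) (k : nat) (U : set V)
    (f : V -> W) : Prop :=
  match k with
  | 0 => forall x, U x -> {for x, continuous f}
  | k'.+1 => (forall x, U x -> differentiable f x) /\
             (forall v : V, Ck k' U (fun x => 'D_v f x))
  end.

Definition smooth_on (R : realType) (V W : normedModType R) (U : set V)
    (f : V -> W) : Prop := forall k, Ck k U f.

(* [chart_inv] is only meaningful on [chart_cod], and [chart_fun] on
   [chart_dom]; both are total functions with arbitrary values elsewhere. *)
Record chart (R : realType) (n : nat) (T : topologicalType) := Chart {
  chart_dom : set T;
  chart_fun : T -> 'rV[R]_n;
  chart_inv : 'rV[R]_n -> T;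
  chart_cod : set 'rV[R]_n := chart_fun @` chart_dom;
  chart_dom_open : open chart_dom;
  chart_cod_open : open chart_cod;
  chart_funK : forall x, chart_dom x -> chart_inv (chart_fun x) = x;
  chart_fun_continuous : forall x, chart_dom x -> {for x, continuous chart_fun};
  chart_inv_continuous : forall y, chart_cod y -> {for y, continuous chart_inv}
}.

(* Smooth (Hausdorff, second countable) manifolds of dimension [n].  The
   preferred chart [chart_at x] around each point only serves to represent
   tangent vectors at [x] by their coordinates. *)
Record manifold (R : realType) (n : nat) := Manifold {
  manifold_sort :> topologicalType;
  manifold_hausdorff : hausdorff_space manifold_sort;
  manifold_second_countable : @second_countable manifold_sort;
  atlas : set (chart R n manifold_sort);
  chart_at : manifold_sort -> chart R n manifold_sort;
  chart_at_atlas : forall x, atlas (chart_at x);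
  chart_at_dom : forall x, chart_dom (chart_at x) x;
  atlas_smooth : forall c d, atlas c -> atlas d ->
    smooth_on (chart_fun c @` (chart_dom c `&` chart_dom d))
              (chart_fun d \o chart_inv c)
}.

Section ManifoldCalculus.
Context {R : realType} {n : nat} {M : manifold R n}.

(* A tangent vector at [x] is given by its components in [chart_at x]. *)
Definition tangent (x : M) : lmodType R := 'rV[R]_n.

(* The tangent vector at [chart_inv c y] with components [v] in the chart [c]. *)
Definition of_chart (c : chart R n M) (y v : 'rV[R]_n) :
    tangent (chart_inv c y) :=
  'd (chart_fun (chart_at (chart_inv c y)) \o chart_inv c) y v.

Definition Ck_fun (k : nat) (f : M -> R) : Prop :=
  forall c, atlas c -> Ck k (chart_cod c) (f \o chart_inv c : _ -> R^o).

Definition differential (f : M -> R) (x : M) (v : tangent x) : R :=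
  'd (f \o chart_inv (chart_at x) : _ -> R^o) (chart_fun (chart_at x) x) v.

Definition velocity (g : R -> M) (t : R) : tangent (g t) :=
  derive1 (chart_fun (chart_at (g t)) \o g) t.

(* C^1 curves on [0, 1], i.e. restrictions to [0, 1] of C^1 curves defined on
   some open interval around it. *)
Definition C1_curve (g : R -> M) : Prop :=
  exists2 e : R, 0 < e &
    (forall t, t \in `]- e, 1 + e[ -> {for t, continuous g}) /\
    (forall c, atlas c ->
      Ck 1 ([set` `]- e, 1 + e[] `&` g @^-1` chart_dom c : set R^o)
           (chart_fun c \o g)).

(* Piecewise C^1 paths from [x] to [y], as lists of consecutive C^1 pieces,
   each parametrized by [0, 1]. *)
Fixpoint is_path (x : M) (s : seq (R -> M)) (y : M) : Prop :=
  match s with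
  | [::] => x = y
  | g :: s' => [/\ C1_curve g, g 0 = x & is_path (g 1) s' y]
  end.

End ManifoldCalculus.

Record riemannian_manifold (R : realType) (n : nat) := RiemannianManifold {
  riemannian_base :> manifold R n;
  inner : forall x : riemannian_base, tangent x -> tangent x -> R;
  inner_linear : forall x a (u v w : tangent x),
    inner (a *: u + v) w = a * inner u w + inner v w;
  inner_sym : forall x (u v : tangent x), inner u v = inner v u;
  inner_pos : forall x (u : tangent x), u != 0 -> 0 < inner u u;
  inner_smooth : forall (c : chart R n riemannian_base) (a b : 'rV[R]_n),
    atlas c ->
    smooth_on (chart_cod c)
      (fun y => inner (of_chart c y a) (of_chart c y b) : R^o)
}.

Section Riemannian.
Context {R : realType} {n : nat} {M : riemannian_manifold R n}.

(* The gradient is the tangent vector representing the differential; the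
   default value 0 is irrelevant, since such a vector exists and is unique. *)
Definition grad (f : M -> R) (x : M) : tangent x :=
  xget 0 [set u : tangent x | forall v, inner u v = differential f v].

Definition curve_length (g : R -> M) : \bar R :=
  (\int[lebesgue_measure]_(t in `[0%R, 1%R])
     (Num.sqrt (inner (velocity g t) (velocity g t)))%:E)%E.

(* Equal to [+oo] when the points are in distinct connected components. *)
Definition riemannian_dist (x y : M) : \bar R :=
  ereal_inf [set (\sum_(g <- s) curve_length g)%E | s in [set s | is_path x s y]].

End Riemannian.

Definition riemannian_complete (R : realType) (n : nat)
    (M : riemannian_manifold R n) : Prop :=
  forall u : nat -> M,
    (forall e : R, 0 < e -> exists N, forall i j, (N <= i)%N -> (N <= j)%N ->
       (riemannian_dist (u i) (u j) < e%:E)%E) ->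
    exists x : M, u @ \oo --> x.

(* The constraints are indexed by 'I_(m + l): the inequality constraints are
   the [lshift l i] for [i : 'I_m] and the equality constraints the
   [rshift m i] for [i : 'I_l].  A multiplier is a row vector [lam], with
   parts [lsubmx lam] and [rsubmx lam]. *)
Section KKT.
Context {R : realType} {n : nat} {M : riemannian_manifold R n} {m l : nat}.
Variables (f : M -> R) (c : 'I_(m + l) -> M -> R).

Definition KKT_pair (x : M) (lam : 'rV[R]_(m + l)) : Prop :=
  [/\ grad f x + \sum_(i < m + l) lam 0 i *: grad (c i) x = 0,
      forall i : 'I_m, [/\ 0 <= lam 0 (lshift l i), c (lshift l i) x <= 0
                         & lam 0 (lshift l i) * c (lshift l i) x = 0]
    & forall i : 'I_l, c (rshift m i) x = 0].

Definition penalized (rho : R) (x : M) : R :=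
  f x - rho * \sum_(i < l) c (rshift m i) x.

Definition KKT_pair_penalized (rho : R) (x : M) (lam : 'rV[R]_(m + l)) : Prop :=
  grad (penalized rho) x + \sum_(i < m + l) lam 0 i *: grad (c i) x = 0 /\
  forall i : 'I_(m + l), [/\ 0 <= lam 0 i, c i x <= 0 & lam 0 i * c i x = 0].

End KKT.

(* Main.v *)
Require Import Defs.
From HB Require Import structures.
From mathcomp Require Import all_boot all_order all_algebra.
From mathcomp Require Import all_classical all_reals all_analysis.

Import Order.TTheory GRing.Theory Num.Theory.
Import numFieldNormedType.Exports.

Local Open Scope ring_scope.

(** The Lagrangian gradients of (P) and (P_rho) are the same vector once the
    multipliers of the equality constraints are shifted by [rho]:
    [grad F_rho = grad f - rho * \sum_(i in E) grad c_i], so that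
    [grad F_rho + \sum_i lam_i grad c_i] is
    [grad f + \sum_(i in I) lam_i grad c_i
            + \sum_(i in E) (lam_i - rho) grad c_i]
    ([penalized_stationarity]).  At a point where the equality constraints
    hold, complementarity for them is trivial and their multipliers have no
    sign condition in (P), whereas the sign condition of (P_rho) is the
    hypothesis of the second implication.

    The substance is therefore the linearity of [grad].  Differentials are
    linear in the function at points of differentiability.  To transfer this
    to gradients, one needs that the vector representing a differential really
    exists (otherwise [grad] would take its default value) and is unique: this
    is the Riesz representation theorem on the finite-dimensional tangent
    space, which holds because the Gram matrix of the metric is invertible. *)

Lemma diff_sum (R : realType) (V W : normedModType R) (l : nat)
    (g : 'I_l -> V -> W) (y v : V) : (forall i, differentiable (g i) y) ->
  'd (\sum_(i < l) g i) y v = \sum_(i < l) 'd (g i) y v.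
Proof.
elim: l g => [|l IHl] g dg; first by rewrite !big_ord0 diff_cst.
rewrite !big_ord_recr/= diffD//; last exact: differentiable_sum.
by rewrite /= IHl.
Qed.

Section Gradient.
Context {R : realType} {n : nat} {M : riemannian_manifold R n}.
Implicit Types (f g : M -> R) (x : M).

Lemma inner0l {x} (w : tangent x) : inner 0 w = 0.
Proof.
have := inner_linear 1 0 0 w.
by rewrite scale1r addr0 mul1r => /esym/eqP; rewrite -subr_eq0 addrK => /eqP.
Qed.

Lemma innerDl {x} (u v w : tangent x) :
  inner (u + v) w = inner u w + inner v w.
Proof. by have := inner_linear 1 u v w; rewrite scale1r mul1r. Qed.

Lemma innerZl {x} a (u w : tangent x) : inner (a *: u) w = a * inner u w.
Proof. by have := inner_linear a u 0 w; rewrite addr0 inner0l addr0. Qed.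

Lemma inner_suml {x} (I : finType) (u : I -> tangent x) w :
  inner (\sum_i u i) w = \sum_i inner (u i) w.
Proof.
exact: (big_morph (fun u => inner u w) (fun u v => innerDl u v w) (inner0l w)).
Qed.

(** Two vectors with the same inner products differ by a vector of norm 0. *)
Lemma inner_injl {x} (u v : tangent x) :
  (forall w, inner u w = inner v w) -> u = v.
Proof.
move=> uv; apply/eqP; rewrite -subr_eq0; apply/negPn/negP => /inner_pos.
by rewrite innerDl -scaleN1r innerZl uv mulN1r subrr ltxx.
Qed.

Definition gram x : 'M[R]_n :=
  \matrix_(i, j) @inner _ _ M x (delta_mx 0 i) (delta_mx 0 j).

Lemma mul_gramE {x} (u : 'rV[R]_n) j :
  (u *m gram x) 0 j = @inner _ _ M x u (delta_mx 0 j).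
Proof.
rewrite [u in RHS]row_sum_delta inner_suml mxE.
by apply: eq_bigr => i _; rewrite innerZl mxE.
Qed.

Lemma linear_form_delta (phi : {linear 'rV[R]_n -> R^o}) v :
  phi v = \sum_j v 0 j * phi (delta_mx 0 j).
Proof.
rewrite [v in LHS]row_sum_delta linear_sum.
by apply: eq_bigr => j _; rewrite linearZ.
Qed.

(** A vector in the kernel of the Gram matrix is orthogonal to the standard
    basis, hence to the whole tangent space, hence zero. *)
Lemma gram_unit x : gram x \in unitmx.
Proof.
rewrite -row_free_unit -kermx_eq0; apply/rowV0P => u /sub_kermxP uG0.
apply: (@inner_injl x) => w; rewrite inner0l inner_sym.
rewrite [w]row_sum_delta inner_suml big1// => j _.
by rewrite innerZl inner_sym -mul_gramE uG0 mxE mulr0.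
Qed.

(** Riesz representation: in coordinates, the vector [u] representing [phi]
    solves the linear system [u *m gram x = (phi e_j)_j]. *)
Lemma riesz_representation x (phi : {linear 'rV[R]_n -> R^o}) :
  exists u : tangent x, forall v, inner u v = phi v.
Proof.
exists ((\row_j phi (delta_mx 0 j)) *m invmx (gram x)) => v.
rewrite inner_sym [v in LHS]row_sum_delta inner_suml linear_form_delta.
apply: eq_bigr => j _.
by rewrite innerZl inner_sym -mul_gramE mulmxKV ?gram_unit// mxE.
Qed.

Lemma inner_grad f x (v : tangent x) : inner (grad f x) v = differential f v.
Proof.
have [u ufx] := riesz_representation x
  ('d (f \o chart_inv (chart_at x) : _ -> R^o) (chart_fun (chart_at x) x)).
by rewrite /grad; case: xgetP => [w _|/(_ u)]; [exact|case].
Qed.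

Lemma grad_eq f x (u : tangent x) :
  (forall v, inner u v = differential f v) -> grad f x = u.
Proof. by move=> uf; apply: inner_injl => v; rewrite inner_grad uf. Qed.

(** Stated in the preferred chart since [differential] is computed there. *)
Definition differentiable_in_chart f x : Prop :=
  differentiable (f \o chart_inv (chart_at x) : _ -> R^o)
                 (chart_fun (chart_at x) x).

Lemma Ck_fun_differentiable k f x : Ck_fun k.+1 f -> differentiable_in_chart f x.
Proof.
move=> /(_ _ (chart_at_atlas x)) [df _]; apply: df.
by exists x => //; exact: chart_at_dom.
Qed.

(** The gradient inherits linearity from the differential because it is
    characterized by it ([inner_grad], [grad_eq]).  Differentiability matters:
    the differential of a non-differentiable function is a default value, which
    is not additive in the function.  The combination is the one that appears
    in [penalized]. *)
Lemma grad_sub_sum {l : nat} f (g : 'I_l -> M -> R) (a : R) x :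
  differentiable_in_chart f x -> (forall i, differentiable_in_chart (g i) x) ->
  grad (fun y => f y - a * \sum_(i < l) g i y) x =
  grad f x - a *: \sum_(i < l) grad (g i) x.
Proof.
move=> df dg; apply: grad_eq => v.
rewrite innerDl -scaleNr innerZl inner_suml inner_grad.
under eq_bigr do rewrite inner_grad.
set y := chart_fun (chart_at x) x; set h := chart_inv (chart_at x).
pose G i : 'rV[R]_n -> R^o := g i \o h.
have dG : differentiable (\sum_(i < l) G i) y by apply: differentiable_sum.
rewrite /differential.
have -> : (fun y => f y - a * \sum_(i < l) g i y) \o h =
  (f \o h : 'rV[R]_n -> R^o) - a *: (\sum_(i < l) G i).
  by apply/funext => z /=; rewrite !fctE fct_sumE.
rewrite diffB//; last exact: differentiableZ.
by rewrite /= diffZ//= diff_sum// mulNr.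
Qed.

End Gradient.

Section Stationarity.
Context {R : realType} {n : nat} {M : riemannian_manifold R n} {m l : nat}.
Variables (f : M -> R) (c : 'I_(m + l) -> M -> R).

(** The penalty contributes [- rho] times the gradient of each equality
    constraint, which is absorbed by the shift of the corresponding
    multiplier. *)
Lemma penalized_stationarity (rho : R) (x : M) (lam : 'rV[R]_(m + l)) :
  differentiable_in_chart f x -> (forall i, differentiable_in_chart (c i) x) ->
  grad (penalized f c rho) x + \sum_(i < m + l) lam 0 i *: grad (c i) x =
  grad f x + \sum_(i < m + l)
    (row_mx (lsubmx lam) (rsubmx lam - rho *: const_mx 1)) 0 i *: grad (c i) x.
Proof.
move=> df dc.
rewrite (grad_sub_sum f (fun i => c (rshift m i)))// -addrA; congr (_ + _).
rewrite !big_split_ord /= addrCA; congr (_ + _).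
  by apply: eq_bigr => i _; rewrite row_mxEl mxE.
rewrite addrC scaler_sumr -sumrB; apply: eq_bigr => i _.
by rewrite row_mxEr !mxE mulr1 scalerBl.
Qed.

End Stationarity.

Theorem proposition3p1 (R : realType) (n : nat) (M : riemannian_manifold R n)
    (M_complete : riemannian_complete M) (m l : nat)
    (f : M -> R) (c : 'I_(m + l) -> M -> R)
    (f_C2 : Ck_fun 2 f) (c_C2 : forall i, Ck_fun 2 (c i))
    (rho : R) (rho_gt0 : 0 < rho) :
  (forall (x : M) (lam : 'rV[R]_(m + l)),
     KKT_pair_penalized f c rho x lam ->
     (forall i : 'I_l, c (rshift m i) x = 0) ->
     KKT_pair f c x (row_mx (lsubmx lam) (rsubmx lam - rho *: const_mx 1))) /\
  (forall (x : M) (lam : 'rV[R]_(m + l)),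
     (forall i : 'I_l, 0 <= rsubmx lam 0 i) ->
     KKT_pair f c x (row_mx (lsubmx lam) (rsubmx lam - rho *: const_mx 1)) ->
     KKT_pair_penalized f c rho x lam).
Proof.
have df x := Ck_fun_differentiable 1 f x f_C2.
have dc x i := Ck_fun_differentiable 1 (c i) x (c_C2 i).
split=> x lam.
- move=> [stat sgn] cE0; split=> // [|i].
    by rewrite -penalized_stationarity.
  by have [] := sgn (lshift l i); rewrite row_mxEl mxE; split.
- move=> lamE_ge0 [stat sgnI cE0]; split=> [|i].
    by rewrite penalized_stationarity.
  case: (split_ordP i) => j ->.
    by have [] := sgnI j; rewrite row_mxEl mxE; split.
  by have := lamE_ge0 j; rewrite mxE cE0 mulr0; split.
Qed.
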